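(* Let $(x_n),(y_n)$ be the sequences generated by the stochastic Halpern-Mann iteration $$y_n:=(1-\alpha_n)(Tx_n+\xi_n)+\alpha_nu,\qquad x_{n+1}:=(1-\beta_n)(Uy_n+\delta_n)+\beta_ny_n .$$ Assume that $K_0\in\mathbb{N}^*$ is such that $\mathbb{E}[\|Tx_n-u\|],\mathbb{E}[\|Uy_n-y_n\|],\mathbb{E}[\|Uu-u\|],\mathbb{E}[\|Uy_n-u\|]\le K_0$ for all $n\in\mathbb{N}$. Suppose that $\sum_{n=0}^\infty\alpha_n=\infty$ with rate of divergence $\theta$, that $$\sum_{n=0}^\infty \mathbb{E}[\|\xi_{n+1}-\xi_n\|],\quad \sum_{n=0}^\infty\mathbb{E}[\|\delta_{n+1}-\delta_n\|],\quad \sum_{n=0}^\infty|\alpha_{n+1}-\alpha_n|,\quad \sum_{n=0}^\infty|\beta_{n+1}-\beta_n|$$ are all finite, with rates of convergence $\chi_1,\chi_2,\chi_3,\chi_4$ and upper bounds $B_1,B_2,B_3,B_4$, respectively, and that $\mathbb{E}[\|\xi_n\|]\le E_0$ and $\mathbb{E}[\|\delta_n\|]\le D_0$ for all $n\in\mathbb{N}$. Let $\varphi$ be a rate for $\mathbb{E}[\|x_{n+1}-x_n\|]\to0$ and let $$\chi(\varepsilon):=\max\left\{\chi_1\left(\tfrac{\varepsilon}{4}\right),\chi_2\left(\tfrac{\varepsilon}{4}\right),\chi_3\left(\tfrac{\varepsilon}{4(E_0+K_0)}\right),\chi_4\left(\tfrac{\varepsilon}{4(D_0+K_0)}\right)\right\}.$$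 Then $\mathbb{E}[\|y_{n+1}-y_n\|]\to0$ with rate $$\varphi'(\varepsilon):=\max\left\{\varphi\left(\tfrac{\varepsilon}{3}\right),\chi_1\left(\tfrac{\varepsilon}{3}\right),\chi_3\left(\tfrac{\varepsilon}{3(K_0+E_0)}\right)\right\},$$ and $\|y_{n+1}-y_n\|\to0$ almost surely with rate $$\psi'(\lambda,\varepsilon):=\max\left\{\varphi'\left(\tfrac{\lambda\varepsilon}{2}\right),\chi\left(\tfrac{\lambda\varepsilon}{2}\right)\right\}.$$
   Context: $\mathbb{N}=\{0,1,2,\dots\}$, $\mathbb{N}^*=\mathbb{N}\setminus\{0\}$. $(\Omega,\mathcal{F},\mathbb{P})$ is a probability space, $(X,\|\cdot\|)$ is a separable real normed space, and an $X$-valued random variable is a measurable function $\Omega\to X$. $T,U:X\to X$ are nonexpansive ($\|Tx-Ty\|\le\|x-y\|$, $\|Ux-Uy\|\le\|x-y\|$ for all $x,y\in X$); $x_0$ (the starting point) and $u$ (the anchor) are arbitrary $X$-valued random variables; $(\xi_n),(\delta_n)$ are sequences of $X$-valued random variables; $(\alpha_n),(\beta_n)\subseteq[0,1]$ are deterministic. Rates. For nonnegative reals $(a_n)$: a rate (of convergence) for $a_n\to0$ is a function $\varphi:(0,\infty)\to\mathbb{N}$ with $a_n<\varepsilon$ for all $\varepsilon>0$ and $n\ge\varphi(\varepsilon)$. A rate of convergence for $\sum_{n=0}^\infty a_n<\infty$ is a function $\chi:(0,\infty)\to\mathbb{N}$ with $\sum_{n=\chi(\varepsilon)}^\infty a_n<\varepsilon$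 for all $\varepsilon>0$. A rate of divergence for $\sum_{n=0}^\infty a_n=\infty$ is a function $\theta:\mathbb{N}\times(0,\infty)\to\mathbb{N}$ with $\sum_{n=k}^{\theta(k,b)}a_n\ge b$ for all $b>0$, $k\in\mathbb{N}$. For nonnegative random variables $(X_n)$: a rate for $X_n\to0$ almost surely is a function $\Phi:(0,\infty)^2\to\mathbb{N}$ with $\mathbb{P}(\exists n\ge\Phi(\lambda,\varepsilon)\,(X_n\ge\varepsilon))<\lambda$ for all $\lambda,\varepsilon>0$. *)

(* Defs.v *)
From HB Require Import structures.
From mathcomp Require Import all_boot all_order all_algebra.
From mathcomp Require Import all_classical all_reals all_analysis.

Set Implicit Arguments.
Unset Strict Implicit.
Unset Printing Implicit Defensive.

Import Order.TTheory GRing.Theory Num.Theory.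
Import numFieldNormedType.Exports.

Local Open Scope classical_set_scope.
Local Open Scope ring_scope.

Definition separable (X : topologicalType) : Prop :=
  exists2 D : set X, countable D & dense D.

(* [X] equipped with its Borel sigma-algebra; the carrier is convertible to [X],
   so that an element of [borel X] can be used as a vector of [X]. *)
Notation borel X := (g_sigma_algebraType (@open X)).

Section Nonexpansive.
Context {R : realType} {X : normedModType R}.

Definition nonexpansive (T : X -> X) : Prop :=
  forall x y : X, `|T x - T y| <= `|x - y|.

End Nonexpansive.

Definition expected_norm d (Omega : measurableType d) (R : realType)
    (P : probability Omega R) (X : normedModType R) (Z : Omega -> X) : \bar R :=
  ('E_P[fun w => `|Z w|%R])%E.

(* Rates are total functions on [R], constrained only at positive arguments.
   Sequences of expectations take values in [\bar R], as an expectation may be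
   infinite; in particular a rate of convergence does not constrain the
   finiteness of the first few terms. *)
Section Rates.
Context {R : realType}.

Definition cvg_rate (a : nat -> \bar R) (phi : R -> nat) : Prop :=
  forall eps : R, 0 < eps ->
  forall n : nat, (phi eps <= n)%N -> (a n < eps%:E)%E.

Definition sum_cvg_rate (a : nat -> \bar R) (chi : R -> nat) : Prop :=
  (\sum_(0 <= n <oo) a n < +oo)%E /\
  forall eps : R, 0 < eps -> (\sum_(chi eps <= n <oo) a n < eps%:E)%E.

Definition sum_div_rate (a : nat -> R) (theta : nat -> R -> nat) : Prop :=
  forall (k : nat) (b : R), 0 < b ->
  b <= \sum_(k <= n < (theta k b).+1) a n.

Definition as_rate d (Omega : measurableType d) (P : probability Omega R)
    (Z : nat -> Omega -> R) (Phi : R -> R -> nat) : Prop :=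
  forall lambda eps : R, 0 < lambda -> 0 < eps ->
  (P [set w | exists n : nat, (Phi lambda eps <= n)%N /\ (eps <= Z n w)%R]
     < lambda%:E)%E.

End Rates.

Section HalpernMann.
Context {R : realType} {X : normedModType R} {Omega : Type}.

Definition halpern_mann (T U : X -> X) (alpha beta : nat -> R)
    (x0 u : Omega -> X) (xi delta : nat -> Omega -> X)
    (x y : nat -> Omega -> X) : Prop :=
  [/\ forall w, x 0%N w = x0 w,
      forall n w, y n w = (1 - alpha n) *: (T (x n w) + xi n w)
                          + alpha n *: u w
    & forall n w, x n.+1 w = (1 - beta n) *: (U (y n w) + delta n w)
                             + beta n *: y n w].

End HalpernMann.

(* Main.v *)
Require Import Defs.
From HB Require Import structures.
From mathcomp Require Import all_boot all_order all_algebra.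
From mathcomp Require Import all_classical all_reals all_analysis.
From mathcomp Require Import measurable_realfun lra.

Set Implicit Arguments.
Unset Strict Implicit.
Unset Printing Implicit Defensive.

Import Order.TTheory GRing.Theory Num.Theory.
Import numFieldNormedType.Exports.

Local Open Scope classical_set_scope.
Local Open Scope ring_scope.

(** Both halves of the iteration have the form
    z_n = (1 - c_n) (v_n + e_n) + c_n b_n. Comparing two consecutive steps, the
    norm of z_{n+1} - z_n is at most the convex combination
    (1 - c_{n+1}) |v_{n+1} - v_n| + c_{n+1} |b_{n+1} - b_n| plus an error
    |e_{n+1} - e_n| + |c_{n+1} - c_n| (|v_n - b_n| + |e_n|) (mann_step).

    Write a_n = |y_{n+1} - y_n|, and let p_n and q_n be the errors of the
    anchored (Halpern) and of the relaxed (Mann) half. Nonexpansiveness of T and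
    U turns mann_step into
      a_n <= |x_{n+1} - x_n| + p_n    and    |x_{n+2} - x_{n+1}| <= a_n + q_n.
    Taking expectations in the first inequality gives the rate of E a_n, as
    E p_n is at most the n-th term of the summable sequence
    E |xi_{n+1} - xi_n| + (E0 + K0) |alpha_{n+1} - alpha_n|.

    Chaining both inequalities gives a_{n+1} <= a_n + (q_n + p_{n+1}) pointwise:
    a is nonincreasing up to a summable error, so that from rank N on it is
    at most a_N + sum_{n >= N} (q_n + p_{n+1}). Markov's inequality for this single
    random variable bounds the probability that a_n >= eps for some n >= N
    (maximal_inequality). At N = psi' lambda eps both E a_N and the sum of the
    expected errors are below lambda eps / 2, which yields the almost sure rate.
    Rates of summability are propagated through sums, multiples and shifts by the
    sum_cvg_rate lemmas; the divisors of eps in phi', chi and psi' are what these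
    operations produce.

    Integrals are additive only on measurable functions, so the iterates have to
    be shown measurable. That a sum of two Borel maps into X is Borel rests on
    the separability of X (borel_measurable_pair). *)

(** * Borel measurability in a separable normed space *)

Definition borel_measurable {d} {Omega : measurableType d}
  {Y : topologicalType} (f : Omega -> Y) : Prop :=
  forall O : set Y, open O -> measurable (f @^-1` O).

Lemma rv_borel_measurable {R : realType} {X : normedModType R}
    d (Omega : measurableType d) (P : probability Omega R)
    (Z : {RV P >-> borel X}) :
  borel_measurable (fun w => Z w : X).
Proof.
move=> O oO; rewrite -[X in measurable X]setTI.
by apply: (@measurable_funPT _ _ _ (borel X) Z) => //; exact: sub_sigma_algebra.
Qed.

Lemma borel_measurable_comp {d} {Omega : measurableType d}
    {Y Y' : topologicalType} {f : Omega -> Y} (h : Y -> Y') :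
  continuous h -> borel_measurable f -> borel_measurable (fun w => h (f w)).
Proof.
by move=> /continuousP ch mf O oO; apply: (mf (h @^-1` O)); exact: ch.
Qed.

Lemma borel_measurable_real {R : realType} d (Omega : measurableType d)
    (f : Omega -> R) :
  borel_measurable f -> measurable_fun [set: Omega] f.
Proof.
move=> mf; apply: (measurability _ (RGenOpens.measurableE R)).
move=> _ [_ [a [b ->] <-]]; rewrite setTI.
by apply: mf; exact: interval_open.
Qed.

Lemma nonexpansive_continuous {R : realType} {X : normedModType R} (T : X -> X) :
  nonexpansive T -> continuous T.
Proof.
move=> neT p; apply/cvgrPdist_lt => e e0; near=> q.
apply: le_lt_trans (neT _ _) _; near: q.
by apply: (@cvgr_dist_lt _ _ _ (nbhs p) _ id p).
Unshelve. all: by end_near. Qed.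

(** A countable dense set is nonempty, hence the range of a sequence; repetitions
    take care of the finite case. *)
Lemma separable_sequence {R : realType} {X : normedModType R} :
  separable X ->
  exists s : nat -> X, forall (p : X) (r : R), 0 < r -> exists n, `|s n - p| < r.
Proof.
move=> [D /pfcard_geP[D0|[s]] dD].
  have [] := dD setT; [by exists 0|exact: openT|].
  by rewrite D0 => p [].
exists s => p r r0.
have [||q [qp Dq]] := dD (ball p r); [by exists p; exact: ballxx|exact: ball_open|].
have [n _ snq] := 'surj_s Dq.
by exists n; rewrite snq distrC; move: qp; rewrite -ball_normE.
Qed.

(** In general the Borel sets of X * X are not generated by products of Borel sets
    of X; when X is separable they are. Indeed an open set W of X * X is the union
    of the balls contained in it whose centre has coordinates in a dense sequence
    and whose radius is 1 / (k + 1). There are countably many such balls, and each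
    is a product of two balls of X, because the distance on X * X is the maximum
    of the distances of the coordinates. *)
Lemma borel_measurable_pair {R : realType} {X : normedModType R}
    {Y : topologicalType} {d} {Omega : measurableType d} {f g : Omega -> X}
    (h : X * X -> Y) : separable X ->
  continuous h -> borel_measurable f -> borel_measurable g ->
  borel_measurable (fun w => h (f w, g w)).
Proof.
move=> /separable_sequence[s sP] /continuousP ch mf mg O oO.
have oW := ch _ oO; set W := h @^-1` O in oW.
pose r (k : nat) : R := k.+1%:R^-1.
have r0 k : 0 < r k by rewrite invr_gt0.
pose B (i : nat * nat * nat) : set (X * X) := ball (s i.1.1, s i.1.2) (r i.2).
pose F i := [set w | B i `<=` W /\ B i (f w, g w)].
suff -> : (fun w => h (f w, g w)) @^-1` O = \bigcup_i F i.
  apply: countable_bigcupT_measurable => [|i]; first exact: countableP.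
  have [BW|nBW] := pselect (B i `<=` W); last first.
    rewrite (_ : F i = set0); first exact: measurable0.
    by apply/seteqP; split => // w [].
  rewrite (_ : F i = f @^-1` ball (s i.1.1) (r i.2) `&`
                     g @^-1` ball (s i.1.2) (r i.2)); last first.
    by apply/seteqP; split => w; [case=> _ []|split].
  by apply: measurableI; [apply: mf|apply: mg]; exact: ball_open.
apply/seteqP; split => [w Ww|w [i _ [BW /BW]]]; last exact.
(* A ball of radius r k < e / 2 around a point closer than r k to (f w, g w) lies
   in the ball of radius e around (f w, g w), hence in W. *)
have /nbhs_ballP[e /= e0 eW] : nbhs (f w, g w) W.
  by apply: open_nbhs_nbhs; split.
have [k rk] : exists k, r k < e / 2.
  have e20 : 0 < e / 2 by rewrite divr_gt0.
  have [k _ /(_ _ (leqnn k)) H] := @near_infty_natSinv_lt R (PosNum e20).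
  by exists k.
have [m mP] := sP (f w) _ (r0 k); have [n nP] := sP (g w) _ (r0 k).
have Bw : B (m, n, k) (f w, g w) by split; rewrite -ball_normE.
exists (m, n, k) => //; split => // q Bq; apply: eW.
apply: (@le_ball _ _ _ (r k + r k)); first by lra.
by apply: ball_triangle Bq; exact: ball_sym.
Qed.

Section BorelOperations.
Context {R : realType} {X : normedModType R} (sepX : separable X).
Context d (Omega : measurableType d).
Implicit Types f g : Omega -> X.

Lemma borel_measurableD f g : borel_measurable f -> borel_measurable g ->
  borel_measurable (fun w => f w + g w).
Proof.
move=> mf mg.
apply: (@borel_measurable_pair R X X d Omega f g (fun p => p.1 + p.2)) => //.
exact: add_continuous.
Qed.

Lemma borel_measurableZ (a : R) f : borel_measurable f ->
  borel_measurable (fun w => a *: f w).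
Proof.
by move=> mf; apply: (@borel_measurable_comp _ _ _ _ _ ( *:%R a)) mf; exact: scaler_continuous.
Qed.

Lemma borel_measurableB f g : borel_measurable f -> borel_measurable g ->
  borel_measurable (fun w => f w - g w).
Proof.
move=> mf mg; apply: borel_measurableD => //.
by apply: borel_measurable_comp mg; exact: opp_continuous.
Qed.

Lemma measurable_norm f : borel_measurable f ->
  measurable_fun [set: Omega] (fun w : Omega => `|f w|).
Proof.
move=> mf; apply: borel_measurable_real; apply: borel_measurable_comp mf.
exact: norm_continuous.
Qed.

Lemma measurable_dist f g : borel_measurable f -> borel_measurable g ->
  measurable_fun [set: Omega] (fun w : Omega => `|f w - g w|).
Proof. by move=> mf mg; exact: measurable_norm (borel_measurableB mf mg). Qed.

End BorelOperations.

(** * Expectations of nonnegative functions and a maximal inequality *)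

Section Expectation.
Context d (Omega : measurableType d) (R : realType) (P : probability Omega R).
Local Open Scope ereal_scope.
Implicit Types f g : Omega -> R.

Lemma ge0_expectationD f g :
  (forall w, 0 <= f w)%R -> measurable_fun setT f ->
  (forall w, 0 <= g w)%R -> measurable_fun setT g ->
  'E_P[fun w => (f w + g w)%R] = 'E_P[f] + 'E_P[g].
Proof.
move=> f0 mf g0 mg; rewrite unlock; under eq_integral do rewrite EFinD.
by rewrite ge0_integralD// => [w _||w _|];
  rewrite ?lee_fin//; exact/measurable_EFinP.
Qed.

Lemma ge0_expectationZl (k : R) f : (0 <= k)%R ->
  (forall w, 0 <= f w)%R -> measurable_fun setT f ->
  'E_P[fun w => (k * f w)%R] = k%:E * 'E_P[f].
Proof.
move=> k0 f0 mf; rewrite unlock; under eq_integral do rewrite EFinM.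
by rewrite ge0_integralZl_EFin// => [w _|];
  rewrite ?lee_fin//; exact/measurable_EFinP.
Qed.

Lemma ge0_expectation_le f g :
  (forall w, 0 <= f w)%R -> measurable_fun setT f -> measurable_fun setT g ->
  (forall w, f w <= g w)%R -> 'E_P[f] <= 'E_P[g].
Proof.
move=> f0 mf mg fg; apply: expectation_le => // [w|].
  exact: le_trans (f0 w) (fg w).
exact/aeW.
Qed.

(** Iterating the recursion, a n <= a N + \sum_(N <= k < n) c k for all n >= N.
    Hence on the event the single function S = a N + \sum_(N <= k <oo) c k is at
    least eps, and Markov's inequality for S gives the bound; its integral is
    computed by monotone convergence. *)
Lemma maximal_inequality (a c : nat -> Omega -> R) (N : nat) (eps : R) :
  (0 < eps)%R ->
  (forall n w, 0 <= a n w)%R -> (forall n, measurable_fun setT (a n)) ->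
  (forall n w, 0 <= c n w)%R -> (forall n, measurable_fun setT (c n)) ->
  (forall n w, a n.+1 w <= a n w + c n w)%R ->
  eps%:E * P [set w | exists n, (N <= n)%N /\ (eps <= a n w)%R] <=
  'E_P[a N] + \sum_(N <= n <oo) 'E_P[c n].
Proof.
move=> e0 a0 ma c0 mc ac; set A := [set w | _].
have mA : measurable A.
  rewrite (_ : A = \bigcup_(n in [set n | (N <= n)%N]) a n @^-1` `[eps, +oo[).
    apply: bigcup_measurable => n _; rewrite -[X in measurable X]setTI.
    exact: ma.
  apply/seteqP; split=> w.
    by move=> [n [Nn en]]; exists n => //=; rewrite in_itv/= andbT.
  by move=> [n Nn] /=; rewrite in_itv/= andbT => en; exists n.
(* Indexing the series from 0 allows integration term by term. *)
pose S w := (a N w)%:E + \sum_(n <oo) (c (n + N)%N w)%:E.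
have mc' n : measurable_fun setT (fun w => (c (n + N)%N w)%:E).
  exact/measurable_EFinP.
have msum : measurable_fun setT (fun w => \sum_(n <oo) (c (n + N)%N w)%:E).
  apply: (@ge0_emeasurable_sum _ _ _ setT (fun n w => (c (n + N)%N w)%:E) predT) => //.
  by move=> n w _ _; rewrite lee_fin.
have sum0 w : 0 <= \sum_(n <oo) (c (n + N)%N w)%:E.
  by apply: nneseries_ge0 => n _ _; rewrite lee_fin.
have S_ge n w : (a (N + n)%N w)%:E <= S w.
  apply: (@le_trans _ _ ((a N w)%:E + \sum_(0 <= k < n) (c (k + N)%N w)%:E)).
    elim: n => [|n IHn]; first by rewrite addn0 big_geq// adde0.
    rewrite addnS big_nat_recr//= addeA.
    apply: le_trans (_ : (a (N + n)%N w + c (N + n)%N w)%:E <= _).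
      by rewrite lee_fin.
    by rewrite EFinD [in c _ _]addnC leeD2r.
  by rewrite leeD2l//; apply: nneseries_lim_ge => k _; rewrite lee_fin.
have -> : 'E_P[a N] + \sum_(N <= n <oo) 'E_P[c n] = \int[P]_w S w.
  rewrite ge0_integralD//; last 2 first.
  - by move=> w _; rewrite lee_fin.
  - exact/measurable_EFinP.
  rewrite integral_nneseries//; last by move=> n w _; rewrite lee_fin.
  rewrite -nneseries_addn; last by move=> n; exact: expectation_ge0.
  by rewrite unlock.
have <- : \int[P]_w (eps%:E * (\1_A w)%:E) = eps%:E * P A.
  rewrite ge0_integralZl_EFin//.
  - by rewrite integral_indic// setIT.
  - by apply/measurable_EFinP; exact: measurable_indic.
  - exact: ltW.
apply: ge0_le_integral => //.
- by move=> w _; rewrite -EFinM lee_fin mulr_ge0// ltW.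
- apply/measurable_funeM/measurable_EFinP; exact: measurable_indic.
- by apply: emeasurable_funD => //; exact/measurable_EFinP.
- move=> w _; rewrite indicE; case: (boolP (w \in A)) => [|_].
    rewrite inE => -[n [Nn en]]; rewrite mule1.
    apply: le_trans (S_ge (n - N)%N w).
    by rewrite subnKC// lee_fin.
  by rewrite mule0 adde_ge0// lee_fin.
Qed.

End Expectation.

(** * Calculus of rates for convergent series *)

Section SummabilityRates.
Context {R : realType}.
Local Open Scope ereal_scope.
Implicit Types (a b : nat -> \bar R) (chi : R -> nat).

Lemma nneseries_tail_le a (m n : nat) : (forall k, 0 <= a k) -> (m <= n)%N ->
  \sum_(n <= k <oo) a k <= \sum_(m <= k <oo) a k.
Proof.
move=> a0 mn; rewrite (nneseries_split m (n - m))// subnKC// leeDr//.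
by apply: sume_ge0 => k _.
Qed.

(** A rate bounds the tail starting at chi eps only; nonnegativity extends the
    bound to all later tails. *)
Lemma sum_cvg_rate_tail a chi (eps : R) (N : nat) : (forall n, 0 <= a n) ->
  sum_cvg_rate a chi -> (0 < eps)%R -> (chi eps <= N)%N ->
  \sum_(N <= n <oo) a n < eps%:E.
Proof.
move=> a0 [_ aP] e0 /(nneseries_tail_le a0) aN.
exact: le_lt_trans aN (aP _ e0).
Qed.

(** A term is at most the tail that starts with it. *)
Lemma sum_cvg_rate_cvg a chi : (forall n, 0 <= a n) ->
  sum_cvg_rate a chi -> cvg_rate a chi.
Proof.
move=> a0 aP eps e0 n chin; apply: le_lt_trans (sum_cvg_rate_tail a0 aP e0 chin).
by rewrite (nneseries_split n 1)// addn1 big_nat1 leeDl// nneseries_ge0.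
Qed.

Lemma le_sum_cvg_rate a b chi : (forall n, 0 <= a n) -> (forall n, a n <= b n) ->
  sum_cvg_rate b chi -> sum_cvg_rate a chi.
Proof.
move=> a0 ab [boo bP].
have ab_tail N : \sum_(N <= n <oo) a n <= \sum_(N <= n <oo) b n.
  exact: lee_nneseries.
by split=> [|eps e0]; apply: le_lt_trans (ab_tail _) _ => //; exact: bP.
Qed.

(** The tail of the shifted series from N is the tail of the original series from
    N + 1, so the rate need not change. *)
Lemma sum_cvg_rateS a chi : (forall n, 0 <= a n) ->
  sum_cvg_rate a chi -> sum_cvg_rate (fun n => a n.+1) chi.
Proof.
move=> a0 aP.
have shift N : \sum_(N <= n <oo) a n.+1 = \sum_(N.+1 <= n <oo) a n.
  rewrite -(nneseries_addn (f := fun n => a n.+1))// -[RHS]nneseries_addn//.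
  by under eq_eseriesr do rewrite -addnS.
split=> [|eps e0]; rewrite shift.
  by apply: le_lt_trans aP.1; exact: nneseries_tail_le.
exact: sum_cvg_rate_tail aP e0 (leqnSn _).
Qed.

Lemma sum_cvg_rateD a b chi chi' :
  (forall n, 0 <= a n) -> (forall n, 0 <= b n) ->
  sum_cvg_rate a chi -> sum_cvg_rate b chi' ->
  sum_cvg_rate (fun n => a n + b n)
    (fun eps => maxn (chi (eps / 2)%R) (chi' (eps / 2)%R)).
Proof.
move=> a0 b0 aP bP; split=> [|eps e0]; rewrite nneseriesD//.
  by rewrite lte_add_pinfty ?aP.1 ?bP.1.
have e20 : (0 < eps / 2)%R by rewrite divr_gt0.
rewrite (splitr eps) EFinD lteD// -splitr.
  exact: sum_cvg_rate_tail aP e20 (leq_maxl _ _).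
exact: sum_cvg_rate_tail bP e20 (leq_maxr _ _).
Qed.

Lemma sum_cvg_rateZ a chi (k : R) : (forall n, 0 <= a n) -> (0 < k)%R ->
  sum_cvg_rate a chi ->
  sum_cvg_rate (fun n => k%:E * a n) (fun eps => chi (eps / k)%R).
Proof.
move=> a0 k0 aP; split=> [|eps e0]; rewrite nneseriesZl//.
  by rewrite lte_mul_pinfty ?aP.1// lee_fin ltW.
rewrite -lte_pdivlMl// -EFinM [(eps / k)%R]mulrC.
by apply: sum_cvg_rate_tail aP _ _ => //; rewrite mulr_gt0// invr_gt0.
Qed.

End SummabilityRates.

(** * One step of a perturbed Mann iteration *)

Section MannStep.
Context {R : realType} {X : normedModType R}.

(** The part of the distance between (1 - c') (v' + e') + c' b' and
    (1 - c) (v + e) + c b that comes from changing the weight and the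
    perturbation. *)
Definition mann_error (c' c : R) (e' e v b : X) : R :=
  `|e' - e| + `|c' - c| * (`|v - b| + `|e|).

Lemma mann_error_ge0 c' c e' e v b : 0 <= mann_error c' c e' e v b.
Proof. by rewrite addr_ge0// mulr_ge0// addr_ge0. Qed.

(** Replacing the weight c by c' moves (1 - c) z + c b by (c' - c) (b - z); after
    that both points carry the same weight c' and can be compared term by term. *)
Lemma mann_step (c' c : R) (v' v e' e b' b : X) : 0 <= c' <= 1 ->
  `|((1 - c') *: (v' + e') + c' *: b') - ((1 - c) *: (v + e) + c *: b)| <=
  (1 - c') * `|v' - v| + c' * `|b' - b| + mann_error c' c e' e v b.
Proof.
move=> /andP[c0 c1].
have splitc (z : X) : (1 - c) *: z + c *: b =
    (1 - c') *: z + c' *: b + (c' - c) *: (z - b).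
  have -> : 1 - c = (1 - c') + (c' - c) by rewrite addrA subrK.
  have {2}-> : c = c' - (c' - c) by rewrite subKr.
  by rewrite scalerDl [(c' - _) *: b]scalerBl scalerBr addrACA.
have -> : ((1 - c') *: (v' + e') + c' *: b') - ((1 - c) *: (v + e) + c *: b) =
    (1 - c') *: (v' - v) + c' *: (b' - b) +
    ((1 - c') *: (e' - e) - (c' - c) *: (v - b + e)).
  rewrite splitc opprD addrA opprD addrACA -!scalerBr opprD addrACA scalerDr.
  by rewrite [v + e - b]addrAC -!addrA; congr (_ + _); rewrite addrCA.
have c'0 : 0 <= 1 - c' by rewrite subr_ge0.
apply: le_trans (ler_normD _ _) _; apply: lerD.
  by apply: le_trans (ler_normD _ _) _; rewrite !normrZ !ger0_norm.
apply: le_trans (ler_normB _ _) _; apply: lerD.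
  by rewrite normrZ ger0_norm// ler_piMl// gerBl.
by rewrite normrZ ler_wpM2l// ler_normD.
Qed.

End MannStep.

(** * Summability of the expected errors *)

Section MannErrorExpectation.
Context {R : realType} {X : normedModType R} (sepX : separable X).
Context d (Omega : measurableType d) (P : probability Omega R).

Lemma measurable_mann_error (c' c : R) (e' e v b : Omega -> X) :
  borel_measurable e' -> borel_measurable e ->
  borel_measurable v -> borel_measurable b ->
  measurable_fun [set: Omega]
    (fun w : Omega => mann_error c' c (e' w) (e w) (v w) (b w)).
Proof.
move=> me' me mv mb; apply: measurable_funD.
  exact: (measurable_dist sepX me' me).
apply: measurable_funM => //; apply: measurable_funD; last exact: (measurable_norm me).
exact: (measurable_dist sepX mv mb).
Qed.

Lemma expected_mann_error_le (c' c K E : R) (e' e v b : Omega -> X) :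
  borel_measurable e' -> borel_measurable e ->
  borel_measurable v -> borel_measurable b ->
  (expected_norm P (fun w => v w - b w)%R <= K%:E)%E ->
  (expected_norm P e <= E%:E)%E ->
  ('E_P[fun w => mann_error c' c (e' w) (e w) (v w) (b w)] <=
   expected_norm P (fun w => e' w - e w)%R + (E + K)%:E * `|c' - c|%:E)%E.
Proof.
move=> me' me mv mb vbK eE.
have mvb : measurable_fun [set: Omega] (fun w => `|v w - b w|).
  exact: (measurable_dist sepX mv mb).
have mne := measurable_norm me.
rewrite ge0_expectationD//; last 2 first.
- exact: (measurable_dist sepX me' me).
- by apply: measurable_funM => //; exact: measurable_funD.
rewrite leeD2l// ge0_expectationZl//; last exact: measurable_funD.
rewrite muleC lee_wpmul2r ?lee_fin// ge0_expectationD// addrC EFinD.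
exact: leeD.
Qed.

(** The expected error is at most E |e_{n+1} - e_n| + (E + K) |c_{n+1} - c_n|,
    and each summand receives half of eps. *)
Lemma sum_cvg_rate_mann_error (c : nat -> R) (K E : R)
    (e v b : nat -> Omega -> X) (chi chi' : R -> nat) :
  (forall n, borel_measurable (e n)) -> (forall n, borel_measurable (v n)) ->
  (forall n, borel_measurable (b n)) -> 0 < E + K ->
  (forall n, expected_norm P (fun w => v n w - b n w)%R <= K%:E)%E ->
  (forall n, expected_norm P (e n) <= E%:E)%E ->
  sum_cvg_rate (fun n => expected_norm P (fun w => e n.+1 w - e n w)) chi ->
  sum_cvg_rate (fun n => `|c n.+1 - c n|%:E) chi' ->
  sum_cvg_rate
    (fun n => 'E_P[fun w =>
       mann_error (c n.+1) (c n) (e n.+1 w) (e n w) (v n w) (b n w)])%E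
    (fun eps => maxn (chi (eps / 2)) (chi' (eps / 2 / (E + K)))).
Proof.
move=> me mv mb EK vbK eE eP cP.
apply: (@le_sum_cvg_rate R _ (fun n =>
    (expected_norm P (fun w => e n.+1 w - e n w)%R +
     (E + K)%:E * `|c n.+1 - c n|%:E)%E)).
- by move=> n; apply: expectation_ge0 => w; exact: mann_error_ge0.
- by move=> n; exact: expected_mann_error_le.
apply: (sum_cvg_rateD (chi' := fun eps => chi' (eps / (E + K)))) => //.
- by move=> n; apply: expectation_ge0.
- by move=> n; rewrite -EFinM lee_fin mulr_ge0// ltW.
- exact: (sum_cvg_rateZ (a := fun n => `|c n.+1 - c n|%:E)).
Qed.

End MannErrorExpectation.

(** * Measurability and one-step bounds for the Halpern-Mann iteration *)

Lemma halpern_mann_measurable {R : realType} {X : normedModType R}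
    {d} {Omega : measurableType d} (T U : X -> X) (alpha beta : nat -> R)
    (x0 u : Omega -> X) (xi delta x y : nat -> Omega -> X) :
  separable X -> nonexpansive T -> nonexpansive U ->
  borel_measurable x0 -> borel_measurable u ->
  (forall n, borel_measurable (xi n)) -> (forall n, borel_measurable (delta n)) ->
  halpern_mann T U alpha beta x0 u xi delta x y ->
  forall n, borel_measurable (x n) /\ borel_measurable (y n).
Proof.
move=> sepX neT neU mx0 mu mxi mdelta [xE yE xSE].
have my n : borel_measurable (x n) -> borel_measurable (y n).
  move=> mx; rewrite (funext (yE n)); apply: borel_measurableD => //.
    apply: borel_measurableZ; apply: borel_measurableD => //.
    by apply: borel_measurable_comp mx; exact: nonexpansive_continuous.
  exact: borel_measurableZ.
suff mx n : borel_measurable (x n) by move=> n; split; [|exact: my].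
elim: n => [|n /my mSn]; first by rewrite (funext xE).
rewrite (funext (xSE n)); apply: borel_measurableD => //.
  apply: borel_measurableZ; apply: borel_measurableD => //.
  by apply: borel_measurable_comp mSn; exact: nonexpansive_continuous.
exact: borel_measurableZ.
Qed.

Section HalpernMannSteps.
Context {R : realType} {X : normedModType R} {Omega : Type}.
Context {T U : X -> X} {alpha beta : nat -> R} {x0 u : Omega -> X}.
Context {xi delta x y : nat -> Omega -> X}.
Hypothesis xyE : halpern_mann T U alpha beta x0 u xi delta x y.

(** The anchor u does not depend on n, so the term with weight alpha n.+1
    vanishes. *)
Lemma halpern_step n w : nonexpansive T -> 0 <= alpha n.+1 <= 1 ->
  `|y n.+1 w - y n w| <= `|x n.+1 w - x n w| +
    mann_error (alpha n.+1) (alpha n) (xi n.+1 w) (xi n w) (T (x n w)) (u w).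
Proof.
move=> neT a01; have [_ yE _] := xyE; rewrite !yE.
apply: le_trans (mann_step _ _ _ _ _ _ _ a01) _.
rewrite subrr normr0 mulr0 addr0; have /andP[a0 _] := a01.
apply: lerD => //; apply: le_trans (neT _ _).
by rewrite ler_piMl// gerBl.
Qed.

(** Both U (y n w) and y n w move by at most |y n.+1 w - y n w|, hence so does
    their convex combination. *)
Lemma krasnoselskii_mann_step n w : nonexpansive U -> 0 <= beta n.+1 <= 1 ->
  `|x n.+2 w - x n.+1 w| <= `|y n.+1 w - y n w| +
    mann_error (beta n.+1) (beta n) (delta n.+1 w) (delta n w) (U (y n w)) (y n w).
Proof.
move=> neU b01; have [_ _ xE] := xyE; rewrite !xE.
apply: le_trans (mann_step _ _ _ _ _ _ _ b01) _.
apply: lerD => //; have /andP[b0 b1] := b01.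
rewrite -[leRHS]mul1r -[in leRHS](subrK (beta n.+1) 1) [leRHS]mulrDl.
by apply: lerD => //; rewrite ler_wpM2l ?subr_ge0//; exact: neU.
Qed.

End HalpernMannSteps.

(** * Rates for the Halpern-Mann iteration *)

Theorem theorem3p3 (R : realType)
  (d : measure_display) (Omega : measurableType d) (P : probability Omega R)
  (X : normedModType R) (sepX : separable X)
  (T U : X -> X) (neT : nonexpansive T) (neU : nonexpansive U)
  (x0 u : {RV P >-> borel X}) (xi delta : nat -> {RV P >-> borel X})
  (alpha beta : nat -> R)
  (alpha01 : forall n, 0 <= alpha n <= 1)
  (beta01 : forall n, 0 <= beta n <= 1)
  (x y : nat -> Omega -> X)
  (xyE : halpern_mann T U alpha beta x0 u xi delta x y)
  (K0 : nat) (K0_gt0 : (0 < K0)%N)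
  (ETx : forall n, (expected_norm P (fun w => T (x n w) - u w)%R <= K0%:R%:E)%E)
  (EUyy : forall n, (expected_norm P (fun w => U (y n w) - y n w)%R <= K0%:R%:E)%E)
  (EUu : (expected_norm P (fun w => U (u w) - (u w : X))%R <= K0%:R%:E)%E)
  (EUyu : forall n, (expected_norm P (fun w => U (y n w) - u w)%R <= K0%:R%:E)%E)
  (theta : nat -> R -> nat) (alpha_div : sum_div_rate alpha theta)
  (chi1 chi2 chi3 chi4 : R -> nat) (B1 B2 B3 B4 : R)
  (xi_rate : sum_cvg_rate
     (fun n => expected_norm P (fun w => (xi n.+1 w : X) - xi n w)) chi1)
  (xi_bound :
     (\sum_(0 <= n <oo) expected_norm P (fun w => (xi n.+1 w : X) - xi n w)%R
        <= B1%:E)%E)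
  (delta_rate : sum_cvg_rate
     (fun n => expected_norm P (fun w => (delta n.+1 w : X) - delta n w)) chi2)
  (delta_bound :
     (\sum_(0 <= n <oo) expected_norm P (fun w => (delta n.+1 w : X) - delta n w)%R
        <= B2%:E)%E)
  (alpha_rate : sum_cvg_rate (fun n => `|alpha n.+1 - alpha n|%:E) chi3)
  (alpha_bound :
     (\sum_(0 <= n <oo) `|alpha n.+1 - alpha n|%R%:E <= B3%:E)%E)
  (beta_rate : sum_cvg_rate (fun n => `|beta n.+1 - beta n|%:E) chi4)
  (beta_bound :
     (\sum_(0 <= n <oo) `|beta n.+1 - beta n|%R%:E <= B4%:E)%E)
  (E0 D0 : R)
  (Exi : forall n, (expected_norm P (fun w => (xi n w : X))%R <= E0%:E)%E)
  (Edelta : forall n, (expected_norm P (fun w => (delta n w : X))%R <= D0%:E)%E)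
  (phi : R -> nat)
  (phi_rate :
     cvg_rate (fun n => expected_norm P (fun w => x n.+1 w - x n w)) phi) :
  let chi (eps : R) : nat :=
    maxn (maxn (chi1 (eps / 4)) (chi2 (eps / 4)))
         (maxn (chi3 (eps / (4 * (E0 + K0%:R))))
               (chi4 (eps / (4 * (D0 + K0%:R))))) in
  let phi' (eps : R) : nat :=
    maxn (phi (eps / 3))
         (maxn (chi1 (eps / 3)) (chi3 (eps / (3 * (K0%:R + E0))))) in
  let psi' (lambda eps : R) : nat :=
    maxn (phi' (lambda * eps / 2)) (chi (lambda * eps / 2)) in
  cvg_rate (fun n => expected_norm P (fun w => y n.+1 w - y n w)) phi' /\
  as_rate P (fun n w => `|y n.+1 w - y n w|) psi'.
Proof.
move=> chi phi' psi'.
have mu := rv_borel_measurable u.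
have mxi n := rv_borel_measurable (xi n).
have mdelta n := rv_borel_measurable (delta n).
have mxy := halpern_mann_measurable sepX neT neU (rv_borel_measurable x0) mu
  mxi mdelta xyE.
have mx n := (mxy n).1; have my n := (mxy n).2.
have mT n : borel_measurable (fun w => T (x n w)).
  by apply: borel_measurable_comp (mx n); exact: nonexpansive_continuous.
have mU n : borel_measurable (fun w => U (y n w)).
  by apply: borel_measurable_comp (my n); exact: nonexpansive_continuous.
have gt0 E (e : nat -> Omega -> X) :
    (forall n, expected_norm P (e n) <= E%:E)%E -> 0 < E + K0%:R.
  move=> /(_ 0%N) eE; rewrite ltr_wpDl ?ltr0n// -lee_fin.
  by apply: le_trans eE; exact: expectation_ge0.
pose a n w := `|y n.+1 w - y n w|.
pose p n w :=
  mann_error (alpha n.+1) (alpha n) (xi n.+1 w) (xi n w) (T (x n w)) (u w).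
pose q n w :=
  mann_error (beta n.+1) (beta n) (delta n.+1 w) (delta n w) (U (y n w)) (y n w).
have p0 n w : 0 <= p n w by exact: mann_error_ge0.
have q0 n w : 0 <= q n w by exact: mann_error_ge0.
have a0 n w : 0 <= a n w by exact: normr_ge0.
have ma n : measurable_fun setT (a n).
  exact: (measurable_dist sepX (my n.+1) (my n)).
have mp n : measurable_fun setT (p n) by exact: measurable_mann_error.
have mq n : measurable_fun setT (q n) by exact: measurable_mann_error.
have p_rate := sum_cvg_rate_mann_error sepX mxi mT (fun=> mu) (gt0 _ _ Exi) ETx
  Exi xi_rate alpha_rate.
have q_rate := sum_cvg_rate_mann_error sepX mdelta mU my (gt0 _ _ Edelta) EUyy
  Edelta delta_rate beta_rate.
have Ep0 n : (0 <= 'E_P[p n])%E by exact: expectation_ge0.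
have Eq0 n : (0 <= 'E_P[q n])%E by exact: expectation_ge0.
have a_rate : cvg_rate (fun n => 'E_P[a n])%E phi'.
  move=> eps e0 n; rewrite /phi' !geq_max => /and3P[phin chi1n chi3n].
  have mdx : measurable_fun setT (fun w => `|x n.+1 w - x n w|).
    exact: (measurable_dist sepX (mx n.+1) (mx n)).
  apply: (@le_lt_trans _ _ ('E_P[fun w => (`|x n.+1 w - x n w| + p n w)%R])%E).
    apply: ge0_expectation_le => //; first exact: measurable_funD.
    by move=> w; exact: (halpern_step xyE).
  rewrite ge0_expectationD//.
  (* The bound on E p_n is itself a sum of two terms; asking for it below
     2 (eps / 3) gives each of them eps / 3. *)
  have -> : eps = eps / 3 + 2 * (eps / 3) by lra.
  rewrite EFinD; apply: lteD.
    by apply: phi_rate phin; rewrite divr_gt0.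
  apply: (sum_cvg_rate_cvg Ep0 p_rate); first by rewrite mulr_gt0// divr_gt0.
  rewrite (mulrC 2) mulfK// geq_max chi1n/= -mulrA -invfM.
  by rewrite [E0 + _]addrC.
split=> // lambda eps l0 e0; set N := psi' lambda eps.
have l20 : 0 < lambda * eps / 2 by rewrite divr_gt0// mulr_gt0.
have c_rate := sum_cvg_rateD Eq0 (fun n => Ep0 n.+1) q_rate
  (sum_cvg_rateS Ep0 p_rate).
have ENa : ('E_P[a N] < (lambda * eps / 2)%:E)%E.
  by apply: a_rate => //; exact: leq_maxl.
have Ec : (\sum_(N <= n <oo) 'E_P[fun w => (q n w + p n.+1 w)%R] <
    (lambda * eps / 2)%:E)%E.
  under eq_eseriesr do rewrite ge0_expectationD//.
  apply: (sum_cvg_rate_tail _ c_rate) => //; first by move=> n; exact: adde_ge0.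
  have : (chi (lambda * eps / 2) <= N)%N by exact: leq_maxr.
  (* Halving twice, once between q and p and once inside each error, produces the
     factor 4 in chi. *)
  have four (r k : R) : r / 2 / 2 / k = r / (4 * k).
    by rewrite -!mulrA -!invfM !mulrA -natrM.
  have four1 (r : R) : r / 2 / 2 = r / 4 by rewrite -(mulr1 4) -four divr1.
  move: (lambda * eps / 2) => r.
  rewrite /= !four four1 /chi !geq_max.
  by move=> /andP[/andP[-> ->] /andP[-> ->]].
have max_a := @maximal_inequality _ _ _ P a (fun n w => q n w + p n.+1 w) N eps e0.
rewrite -(@lte_pmul2l _ eps%:E)//.
apply: le_lt_trans (max_a _ _ _ _ _) _ => //.
- by move=> n w; exact: addr_ge0.
- by move=> n; exact: measurable_funD.
- move=> n w; rewrite addrA.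
  apply: le_trans (halpern_step xyE w neT (alpha01 n.+2)) _; apply: lerD => //.
  exact: (krasnoselskii_mann_step xyE).
- by rewrite -EFinM mulrC (splitr (lambda * eps)) EFinD lteD.
Qed.
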